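(* Let $n,k,r$ be integers such that $r\ge 2$ and $n\ge k\ge 2r+2$, and let $C''=r^{\frac{1}{\lfloor k/(r+1)\rfloor}}$. Then $$m(n,r,k) < \frac{2C''}{r!}\cdot n^{r-1+\frac{1}{\lfloor k/(r+1)\rfloor}}+\frac{2}{(r-1)!}\cdot n^{r-1}.$$
   Context: An $r$-uniform multihypergraph has a finite vertex set and a finite multiset of edges, each edge being an $r$-element set of vertices; the same $r$-set may occur as an edge several times. Its order is the number of vertices and its size is the number of edges counted with multiplicity. A combinatorial batch code (CBC-system) with parameters $(m,k,n)$ is a multihypergraph of order $n$ and size $m$ such that for every $1\le i\le k$ the union of any $i$ edges (counted with multiplicity) contains at least $i$ vertices. For integers $r\ge 2$ and $r+1\le k\le n$, $m(n,r,k)$ denotes the maximum number $m$ of edges such that an $r$-uniform CBC-system with parameters $(m,k,n)$ exists. *)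

(* Defs.v *)
From mathcomp Require Import all_boot.
From mathcomp Require Import boolp classical_sets.

Set Implicit Arguments.
Unset Strict Implicit.
Unset Printing Implicit Defensive.

(* The multiset of edges is a family indexed by 'I_size, so an equal edge at
   two distinct indices is an edge of multiplicity two. *)
Record multihypergraph := MultiHypergraph {
  vertex : finType;
  hsize : nat;
  edge : 'I_hsize -> {set vertex} }.

Definition order (H : multihypergraph) : nat := #|vertex H|.

Definition uniform (r : nat) (H : multihypergraph) : Prop :=
  forall j : 'I_(hsize H), #|edge j| = r.

Definition is_CBC (m k n : nat) (H : multihypergraph) : Prop :=
  [/\ order H = n, hsize H = m &
      forall i : nat, 1 <= i <= k ->
      forall J : {set 'I_(hsize H)}, #|J| = i ->
        i <= #|(\bigcup_(j in J) edge j)%SET| ].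

Definition uniform_CBC_exists (m n r k : nat) : Prop :=
  exists H : multihypergraph, uniform r H /\ is_CBC m k n H.

Definition is_max_size (n r k m : nat) : Prop :=
  uniform_CBC_exists m n r k /\
  forall m' : nat, uniform_CBC_exists m' n r k -> m' <= m.

(* m(n,r,k). The default value 0 is used only when there is no maximum, which
   by max_sizeP does not happen for r < k. *)
Definition max_size (n r k : nat) : nat :=
  xget 0 [set m | is_max_size n r k m]%classic.

Lemma uniform_CBC_bound (m n r k : nat) :
  r < k -> uniform_CBC_exists m n r k -> m <= 'C(n, r) * r.
Proof.
move=> rk [H [Hr [<- <- Hc]]].
have mult (A : {set vertex H}) : #|[set j | edge j == A]| <= r.
  rewrite leqNgt; apply/negP => /card_geqP [s [us ss sub]].
  have cs : #|[set j in s]| = r.+1 by rewrite cardsE (card_uniqP us).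
  have := Hc r.+1 rk _ cs; rewrite leqNgt ltnS => /negP; apply.
  case: s us ss sub {cs} => // j0 s _ _ sub.
  have /sub : j0 \in j0 :: s by rewrite mem_head.
  rewrite inE => /eqP eA; rewrite -(Hr j0) eA; apply: subset_leq_card.
  by apply/bigcupsP => j; rewrite inE => /sub; rewrite inE => /eqP ->.
rewrite -[X in X <= _]card_ord -sum1_card.
rewrite (partition_big (@edge H) (fun A : {set vertex H} => #|A| == r)) /=;
  last by move=> j _; rewrite Hr.
rewrite -card_draws -sum_nat_const.
rewrite [X in _ <= X](eq_bigl (fun A : {set vertex H} => #|A| == r));
  last by move=> A; rewrite inE.
apply: leq_sum => A _; rewrite sum1_card; apply: leq_trans (mult A).
by rewrite cardsE; apply: eq_leq; apply: eq_card.
Qed.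

Lemma uniform_CBC_exists0 (n r k : nat) : uniform_CBC_exists 0 n r k.
Proof.
exists (@MultiHypergraph 'I_n 0 (fun=> finset.set0)); split; first by case.
split=> //; first by rewrite /order card_ord.
move=> i /andP[i0 _] J Ji; move: i0; rewrite -Ji lt0n => /negP[].
by rewrite -leqn0; apply: leq_trans (max_card _) _; rewrite card_ord.
Qed.

Lemma max_sizeP (n r k : nat) : r < k -> is_max_size n r k (max_size n r k).
Proof.
move=> rk; rewrite /max_size; case: xgetP => [_ -> //|].
have exP : exists m, `[<uniform_CBC_exists m n r k>].
  by exists 0; apply/asboolP/uniform_CBC_exists0.
have ubP m : `[<uniform_CBC_exists m n r k>] -> m <= 'C(n, r) * r.
  by move=> /asboolP; apply: uniform_CBC_bound.
case: (ex_maxnP exP ubP) => m /asboolP mP mmax /(_ m)[]; split=> // m' /asboolP.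
exact: mmax.
Qed.

(* Main.v *)
Require Import Defs.
From mathcomp Require Import all_boot all_order all_algebra.
From mathcomp Require Import reals exp.
From mathcomp Require Import zify ring.
Set Implicit Arguments.
Unset Strict Implicit.
Unset Printing Implicit Defensive.
Import Order.TTheory GRing.Theory Num.Theory.

(** The hypergraph statement is reduced to a statement about multigraphs.  For a
    set S of r - 2 vertices, the link of S (the edges through S, with S removed)
    is a multigraph, and i >= 1 of its edges on at most i + 1 - r vertices come
    from i hyperedges on at most i - 1 vertices, which the batch code condition
    forbids for i <= k.  With t = k %/ (r + 1) it therefore suffices that a
    multigraph with many edges has a nonempty set U of at most (r + 1) t edges
    satisfying #|span U| + r <= #|U| + 1, that is, of cyclomatic number at least
    r if it is connected.  Let d be the least integer with r n < d ^ t; `many'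
    will mean (d + r - 1) n edges [dense_subgraph], and averaging over S turns
    this into a bound on the size of the hypergraph [size_bound].

    In the multigraph, pass to a vertex set in which all degrees are at least
    d + r [min_degree_subset].  A minimal set F of edges meeting all the cycles
    of length at most t has fewer than r edges at each vertex: otherwise r short
    cycles, each with a private edge of F at the same vertex, already form a
    suitable U [short_cycles_hitting].  Deleting F leaves a multigraph of girth
    greater than t and minimum degree at least d + 1.  It has at least
    d ^ t > r n nonbacktracking walks of length t from any given vertex, hence
    r + 1 of them have the same end.  Because of the girth, the middle edge of
    such a walk lies on no other one [middle_private].  So, when these walks are
    united one after the other, each of them brings a new edge while both its
    ends are already present, and the difference between the numbers of edges
    and vertices grows at every step [ear_excess, theta_dense].  This yields
    exactly the r independent cycles that are wanted, within (r + 1) t edges. *)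

(** * Nonbacktracking walks in a multigraph *)

(** Edges are indices, and [ed] gives their ends: parallel edges are distinct. *)
Section Multigraph.
Variables (V I : finType) (ed : I -> {set V}).
Implicit Types (U E F J : {set I}) (W X : {set V}) (x y v w : V).
Implicit Types (s : seq (I * V)) (l : option I).

Definition span U : {set V} := \bigcup_(j in U) ed j.

Lemma spanU U1 U2 : span (U1 :|: U2) = span U1 :|: span U2.
Proof. exact: bigcup_setU. Qed.

Lemma span1 j : span [set j] = ed j.
Proof. exact: big_set1. Qed.

Lemma span0 : span set0 = set0.
Proof. exact: big_set0. Qed.

Lemma sub_span U j : j \in U -> ed j \subset span U.
Proof. by move=> jU; apply: bigcup_sup. Qed.

Lemma spanS U1 U2 : U1 \subset U2 -> span U1 \subset span U2.
Proof. by move=> s12; apply/bigcupsP => j /(subsetP s12); apply: sub_span. Qed.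

(** A walk is the list of its steps (edge, vertex reached).  The argument [l] is
    the edge by which [x] has been reached, if any: the first step may not use
    it, so that the suffixes of a walk are again described by [nbwalk]. *)
Fixpoint nbwalk E l x s : bool :=
  if s is a :: s' then
    [&& a.1 \in E, ed a.1 == [set x; a.2], l != Some a.1
      & nbwalk E (Some a.1) a.2 s']
  else true.

Definition endpoint x s : V := last x (unzip2 s).

Definition edges s : {set I} := [set j in unzip1 s].

Lemma edges_nil : edges [::] = set0.
Proof. by apply/setP=> j; rewrite !inE. Qed.

Lemma edges_cons a s : edges (a :: s) = a.1 |: edges s.
Proof. by apply/setP=> j; rewrite !inE. Qed.

Lemma card_edges s : #|edges s| <= size s.
Proof. by rewrite cardsE -(size_map fst); apply: card_size. Qed.

Lemma edges_sub E l x s : nbwalk E l x s -> edges s \subset E.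
Proof.
elim: s l x => [|a s IHs] l x /=; first by rewrite edges_nil sub0set.
by case/and4P=> aE _ _ /IHs sE; rewrite edges_cons subUset sub1set aE.
Qed.

Lemma nbwalk_cat E l x s1 s2 :
  nbwalk E l x (s1 ++ s2) =
  nbwalk E l x s1 &&
  nbwalk E (last l (map Some (unzip1 s1))) (endpoint x s1) s2.
Proof.
by elim: s1 l x => //= a s1 IH l x; rewrite IH /endpoint /= -!andbA.
Qed.

Lemma endpoint_cat x s1 s2 :
  endpoint x (s1 ++ s2) = endpoint (endpoint x s1) s2.
Proof. by rewrite /endpoint /unzip2 map_cat last_cat. Qed.

(** The lemmas on excess follow a graph with edge set [U] and vertex set [W],
    where [W] contains [span U], while a walk is added to it; the next three
    describe the effect of one step from [x] to [y] along [j]. *)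
Lemma span_step W A x y j :
  ed j = [set x; y] -> x \in W ->
  W :|: span (j |: A) = (y |: W) :|: span A.
Proof.
move=> ej xW; rewrite spanU span1 ej; apply/setP=> z; rewrite !inE.
by case: (z =P x) => [->|_]; rewrite ?xW ?orbT //= orbA (orbC (z == _)).
Qed.

Lemma span_grow U W x y j :
  ed j = [set x; y] -> x \in W -> span U \subset W ->
  span (j |: U) \subset y |: W.
Proof.
move=> ej xW UW; rewrite spanU span1 ej !subUset !sub1set !inE xW eqxx orbT.
exact: subset_trans UW (subsetUr _ _).
Qed.

Lemma span_mem U W x y j :
  ed j = [set x; y] -> span U \subset W -> j \in U -> y \in W.
Proof.
move=> ej UW /sub_span/subset_trans/(_ UW)/subsetP; apply.
by rewrite ej !inE eqxx orbT.
Qed.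

(** Each step of a walk that starts in [W] reaches at most one new vertex, and
    does so only along a new edge. *)
Lemma walk_excess E l x s U W :
  nbwalk E l x s -> x \in W -> span U \subset W ->
  #|W :|: span (edges s)| + #|U| <= #|W| + #|U :|: edges s|.
Proof.
elim: s l x U W => [|a s IHs] l x U W /=.
  by rewrite edges_nil span0 !setU0.
case/and4P=> _ /eqP ea _ ws xW UW; rewrite edges_cons setUCA setUA.
rewrite (span_step _ ea xW).
have := IHs _ _ _ _ ws (setU11 _ _) (span_grow ea xW UW).
have [aU|aU] := boolP (a.1 \in U).
  have yW := span_mem ea UW aU.
  by rewrite !(setUidPr (_ : [set _] \subset _)) ?sub1set.
by rewrite !cardsU1 aU; case: (a.2 \notin W); clear; lia.
Qed.

(** If the walk also ends in [W], then its new edges outnumber its new vertices: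
    after leaving [W] it has to come back, and the step by which it comes back
    does not use the edge by which it left since it never turns around. *)
Lemma ear_excess E l x s U W :
  nbwalk E l x s -> x \in W -> endpoint x s \in W -> span U \subset W ->
  ~~ (edges s \subset U) ->
  #|W :|: span (edges s)| + #|U| < #|W| + #|U :|: edges s|.
Proof.
elim: s l x U W => [|a s IHs] l x U W /=; first by rewrite edges_nil sub0set.
case/and4P=> _ /eqP ea _ ws xW wW UW; rewrite edges_cons subUset sub1set.
rewrite setUCA setUA (span_step _ ea xW).
have yW' := setU11 a.2 W; have UW' := span_grow ea xW UW.
have [aU /= sU|aU _] := boolP (a.1 \in U).
  have yW := span_mem ea UW aU.
  by rewrite !(setUidPr (_ : [set _] \subset _)) ?sub1set //; exact: IHs ws _ _ _ _.
have [yW|yW] := boolP (a.2 \in W).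
  by have := walk_excess ws yW' UW'; rewrite !cardsU1 aU yW; clear; lia.
(* The walk cannot stop at the new vertex a.2, which is outside W; and a.1 is
   the only edge of a.1 |: U at a.2, so the next edge is new as well. *)
have sU : ~~ (edges s \subset a.1 |: U).
  case: s ws wW {IHs} => [|b s] /=; first by rewrite /endpoint /= (negPf yW).
  case/and4P=> _ /eqP eb ab _ _; rewrite edges_cons subUset sub1set !inE.
  rewrite negb_and negb_or; apply/orP; left; apply/andP; split.
    by apply: contra ab => /eqP ->.
  apply: contra yW; rewrite setUC in eb; exact: span_mem eb UW.
have wW' : endpoint a.2 s \in a.2 |: W by rewrite inE [X in _ || X]wW orbT.
by have := IHs _ _ _ _ ws yW' wW' UW' sU; rewrite !cardsU1 aU yW; clear; lia.
Qed.

Lemma endpoint_span E l x s :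
  nbwalk E l x s -> endpoint x s \in x |: span (edges s).
Proof.
elim: s l x => [|a s IHs] l x /=; first by rewrite !inE eqxx.
case/and4P=> _ /eqP ea _ /IHs; rewrite edges_cons spanU span1 ea !inE -/(endpoint _ s).
by rewrite /endpoint /= => /orP[]->; rewrite ?orbT.
Qed.

(** * Uniqueness of short walks in large girth *)

(** Girth greater than [t], without mentioning cycles: a nonempty edge set with at
    least as many edges as vertices contains a cycle, and a cycle is such a set. *)
Definition sparse t E := forall J,
  J \subset E -> J != set0 -> #|J| <= t -> #|J| < #|span J|.

(** A closed walk is an ear on its starting vertex alone. *)
Lemma sparse_closed t E l x s :
  sparse t E -> nbwalk E l x s -> endpoint x s = x -> size s <= t -> s = [::].
Proof.
move=> spE ws exs st; case: s => // a s in ws exs st *; exfalso.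
have s0 : edges (a :: s) != set0.
  by apply/set0Pn; exists a.1; rewrite edges_cons !inE eqxx.
have := spE _ (edges_sub ws) s0 (leq_trans (card_edges _) st).
have x1 : x \in [set x] by rewrite inE.
have := ear_excess (U := set0) ws x1.
rewrite exs x1 span0 sub0set subset0 s0 set0U cards0 cards1.
have := subset_leq_card (subsetUr [set x] (span (edges (a :: s)))).
move=> h1 /(_ isT isT isT); move: h1; clear; lia.
Qed.

Lemma nbwalk_fresh t E l x s :
  sparse t E -> nbwalk E l x s -> size s <= t -> x \notin unzip2 s.
Proof.
move=> spE ws st; apply/negP => /mapP[a sa xa].
case/path.splitPr: sa ws st => s1 s2; rewrite -cat_rcons nbwalk_cat size_cat => /andP[ws _] st.
have /(congr1 size) : rcons s1 a = [::]; last by rewrite size_rcons.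
apply: sparse_closed spE ws _ (leq_trans (leq_addr _ _) st).
by rewrite -cats1 endpoint_cat.
Qed.

Lemma nbwalk_edge E l x s j z :
  nbwalk E l x s -> j \in edges s -> z \in ed j -> z \in x :: unzip2 s.
Proof.
elim: s l x => [|a s IHs] l x; first by rewrite edges_nil inE.
case/and4P=> _ /eqP ea _ ws; rewrite edges_cons 2!inE -/(edges s).
case/orP=> [/eqP ->|/(IHs _ _ ws) h /h zs].
  by rewrite ea /= !inE orbA => ->.
by rewrite inE /= zs orbT.
Qed.

Lemma set2_inj x y z : [set x; y] = [set x; z] -> y = z.
Proof.
move=> e; have: y \in [set x; z] by rewrite -e !inE eqxx orbT.
have: z \in [set x; y] by rewrite e !inE eqxx orbT.
by rewrite !inE => /orP[/eqP->|/eqP->] // /orP[] /eqP.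
Qed.

(** After removal of the common beginning, two distinct walks would leave [x]
    by different edges.  If the first edge of the second walk is not on the first
    walk, the second walk is an ear on the first one, and their union has too many
    edges; if it is, the first walk comes back to [x]. *)
Lemma nbwalk_uniq t E l1 l2 x s1 s2 :
  sparse t E -> nbwalk E l1 x s1 -> nbwalk E l2 x s2 ->
  endpoint x s1 = endpoint x s2 -> size s1 + size s2 <= t -> s1 = s2.
Proof.
move=> spE; elim: s1 s2 l1 l2 x => [|a s1 IHs] s2 l1 l2 x w1 w2 e12 st.
  by rewrite (sparse_closed spE w2).
case: s2 w2 e12 st => [|b s2] w2 e12 st.
  by apply: sparse_closed spE w1 e12 _; rewrite addn0 in st.
have [ab|ab] := eqVneq a.1 b.1.
  move: w1 w2 => /= /and4P[_ /eqP ea _ w1] /and4P[_ /eqP eb _ w2].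
  have ab2 : a.2 = b.2 by apply: (@set2_inj x); rewrite -ea -eb ab.
  rewrite -ab2 in w2; rewrite [a]surjective_pairing ab ab2 -surjective_pairing.
  congr (_ :: _); apply: IHs w1 w2 _ _; last by move: st => /=; lia.
  by move: e12; rewrite /endpoint /= ab2.
exfalso.
have xb : x \in ed b.1 by move: w2 => /and4P[_ /eqP -> _ _]; rewrite !inE eqxx.
have [bs1|bs1] := boolP (b.1 \in edges (a :: s1)).
  have /negP[] : x \notin unzip2 (a :: s1).
    by apply: nbwalk_fresh spE w1 _; move: st => /=; lia.
  move: bs1; rewrite edges_cons 2!inE eq_sym (negPf ab) -/(edges s1) => bs1.
  by case/and4P: w1 => _ _ _ w1; exact: nbwalk_edge w1 bs1 xb.
have x1 : x \in [set x] by rewrite inE.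
have := walk_excess (U := set0) w1 x1.
rewrite span0 sub0set cards0 cards1 addn0 set0U => /(_ isT).
set s := a :: s1 in w1 e12 st bs1 *; set W := _ :|: _ => hW.
have xW : x \in W by rewrite !inE eqxx.
have wW : endpoint x (b :: s2) \in W.
  by rewrite -e12; apply: endpoint_span w1.
have bs2 : b.1 \in edges (b :: s2) by rewrite edges_cons !inE eqxx.
have new : ~~ (edges (b :: s2) \subset edges s).
  by apply/subsetPn; exists b.1.
have h := ear_excess w2 xW wW (subsetUr _ _) new.
have sE : edges s :|: edges (b :: s2) \subset E.
  by rewrite subUset (edges_sub w1) (edges_sub w2).
have s0 : edges s :|: edges (b :: s2) != set0.
  by apply/set0Pn; exists b.1; rewrite inE bs2 orbT.
have := spE _ sE s0 (leq_trans (leq_card_setU _ _)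
  (leq_trans (leq_add (card_edges _) (card_edges _)) st)).
have := subset_leq_card (subsetUr [set x] (span (edges s :|: edges (b :: s2)))).
rewrite {2}spanU setUA -/W; move: h hW; clear; lia.
Qed.

(** The arithmetic of [middle_private]: how the parts of two walks of length [t],
    cut at the step of index [t./2] in the first and at any step in the second,
    are compared.  The first conjunct serves for an edge used in the same
    direction by both walks, the second one for opposite directions, where the
    common edge itself is added to one of the parts. *)
Lemma half_split t p1 p2 q1 q2 :
  p1 + p2.+1 = t -> q1 + q2.+1 = t -> p1 = t./2 ->
  (if q1 <= p1 then p1 + q1 <= t else (p2 + q2 <= t) && (q2 < p2))
  /\ (if q1 < p1 then p1.+1 + q1 <= t else (p2.+1 + q2 <= t) && (q2 <= p2))
  /\ (q1 = p1 -> p2 + q2 <= t).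
Proof.
move=> e1 e2 e3; have := odd_double_half t; rewrite -addnn -e3.
have : odd t <= 1 by case: odd.
move: (odd t : nat) => o o1 ht; clear e3; split; last split; last by lia.
  by case: (leqP q1 p1) => h; [lia|apply/andP; split; lia].
by case: (ltnP q1 p1) => h; [lia|apply/andP; split; lia].
Qed.

(** The middle edge of a walk of length [t] determines the walk among those with
    the same ends.  Suppose that it also occurs in [q].  Cutting both walks there
    gives pairs of walks with common ends, before the edge and after it, and at
    least one pair has total length at most [t]; by [nbwalk_uniq] its members
    agree, so they have the same length.  This is impossible unless [q] runs
    through the edge in the same direction and at the same place, and in that
    case both pairs are short. *)
Lemma middle_private t E x p1 a p2 q1 b q2 :
  sparse t E ->
  nbwalk E None x (p1 ++ a :: p2) -> nbwalk E None x (q1 ++ b :: q2) ->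
  endpoint x (p1 ++ a :: p2) = endpoint x (q1 ++ b :: q2) ->
  size (p1 ++ a :: p2) = t -> size (q1 ++ b :: q2) = t ->
  size p1 = t./2 -> a.1 = b.1 -> p1 ++ a :: p2 = q1 ++ b :: q2.
Proof.
move=> spE wp wq; rewrite !endpoint_cat !size_cat /= => epq sp sq p1t ab.
have [same_dir [opp_dir eq_split]] := half_split sp sq p1t.
move: (wp) (wq); rewrite !nbwalk_cat => /andP[wp1 wap] /andP[wq1 wbq].
move: (wap) (wbq) => /= /and4P[aE /eqP ea la wp2] /and4P[bE /eqP eb lb wq2].
have eab : [set endpoint x p1; a.2] = [set endpoint x q1; b.2].
  by rewrite -ea -eb ab.
(* The case where both walks run through the edge in the same direction. *)
have [e1|ne] := eqVneq (endpoint x p1) (endpoint x q1).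
  have e2 : a.2 = b.2 by apply: (@set2_inj (endpoint x p1)); rewrite {2}e1.
  have e3 : endpoint a.2 p2 = endpoint a.2 q2.
    by move: epq; rewrite /endpoint /= e2.
  rewrite -e2 in wq2; have [le|lt] := leqP (size q1) (size p1); last first.
    move: same_dir; rewrite leqNgt lt => /andP[st ss].
    by move: ss; rewrite (nbwalk_uniq spE wp2 wq2 e3 st) ltnn.
  rewrite le in same_dir; have eq1 := nbwalk_uniq spE wp1 wq1 e1 same_dir.
  rewrite -eq1 in eq_split *; rewrite (nbwalk_uniq spE wp2 wq2 e3 (eq_split _)) //.
  by rewrite [a]surjective_pairing ab e2 -surjective_pairing.
(* In the opposite direction, the edge itself belongs to one of the two walks of
   each pair, whence the different lengths. *)
have eq12 : endpoint x p1 = b.2.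
  have : endpoint x p1 \in [set endpoint x q1; b.2] by rewrite -eab !inE eqxx.
  by rewrite !inE (negPf ne) => /eqP.
have eq21 : a.2 = endpoint x q1.
  have : endpoint x q1 \in [set endpoint x p1; a.2] by rewrite eab !inE eqxx.
  by rewrite !inE eq_sym (negPf ne) => /eqP.
have [lt|le] := ltnP (size q1) (size p1).
  have wp1a : nbwalk E None x (rcons p1 a).
    by rewrite -cats1 nbwalk_cat wp1 /= aE ea eqxx la.
  have ep1a : endpoint x (rcons p1 a) = endpoint x q1.
    by rewrite -cats1 endpoint_cat -eq21.
  rewrite lt -(size_rcons p1 a) in opp_dir.
  have := nbwalk_uniq spE wp1a wq1 ep1a opp_dir.
  by move=> eq; move: lt; rewrite -eq size_rcons ltnNge leqnSn.
move: opp_dir; rewrite ltnNge le /= => /andP[st ss].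
rewrite -eq12 in wq2.
have := nbwalk_uniq spE wap wq2 _ st; rewrite {1}/endpoint /= => eq.
by move: ss; rewrite -eq ?ltnn //; move: epq; rewrite /endpoint /= -eq12.
Qed.

Lemma private_edge t E x p :
  sparse t E -> 0 < t -> nbwalk E None x p -> size p = t ->
  exists2 j, j \in edges p & forall q, nbwalk E None x q ->
    endpoint x q = endpoint x p -> size q = t -> j \in edges q -> q = p.
Proof.
move=> spE t0 wp sp.
have lt : t./2 < size p by rewrite sp ltn_half_double -addnn; lia.
have a0 : I * V by case: (p) lt.
have pE := cat_take_drop t./2 p; rewrite (drop_nth a0 lt) in pE.
set a := nth a0 p t./2 in pE.
exists a.1; first by rewrite -pE inE /unzip1 map_cat mem_cat /= mem_head orbT.
move=> q wq epq sq; rewrite inE => /mapP[b bq ab].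
case/path.splitPr: bq wq epq sq => q1 q2 wq epq sq; rewrite -pE in wp epq sp *.
apply/esym; apply: middle_private spE wp wq (esym epq) sp sq _ ab.
by rewrite size_take_min; apply/minn_idPl; rewrite ltnW.
Qed.

(** The first walk has at most one vertex more than it has edges; each further
    one is an ear, because its private edge is new. *)
Lemma theta_dense t E x w ps :
  sparse t E -> 0 < t -> ps != [::] -> uniq ps ->
  (forall p, p \in ps -> [/\ nbwalk E None x p, endpoint x p = w & size p = t]) ->
  exists U, [/\ U \subset E, #|U| <= size ps * t
    & #|x |: span U| + size ps <= #|U| + 2].
Proof.
move=> spE t0 ps0 ups wps.
have [U [UE Ut Ud _ _]] : exists U, [/\ U \subset E, #|U| <= size ps * t,
    #|x |: span U| + size ps <= #|U| + 2, w \in x |: span U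
    & forall j, j \in U -> exists2 p, p \in ps & j \in edges p].
  elim: ps ps0 ups wps => [//|p ps IHps] _ /= /andP[pps ups] wps.
  have [wp ep sp] := wps p (mem_head _ _).
  have [ps0|ps0] := eqVneq ps [::].
    exists (edges p); rewrite ps0 /= mul1n (edges_sub wp).
    have x1 : x \in [set x] by rewrite inE.
    have := walk_excess (U := set0) wp x1.
    rewrite span0 sub0set cards0 cards1 set0U addn0 => /(_ isT) h.
    split=> //.
    - by rewrite -sp card_edges.
    - by move: h; clear; lia.
    - by rewrite -ep; apply: endpoint_span wp.
    by move=> j jp; exists p; rewrite ?mem_head.
  have [|U [UE Ut Ud wU Ups]] := IHps ps0 ups.
    by move=> q qps; apply: wps; rewrite inE qps orbT.
  exists (U :|: edges p).
  have new : ~~ (edges p \subset U).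
    have [j jp jP] := private_edge spE t0 wp sp.
    apply/subsetPn; exists j => //; apply/negP => /Ups[q qps jq].
    have [|wq eq sq] := wps q; first by rewrite inE qps orbT.
    by move: pps; rewrite -(jP q) ?qps ?ep.
  have xW : x \in x |: span U by rewrite setU11.
  rewrite -ep in wU.
  have := ear_excess wp xW wU (subsetUr _ _) new.
  rewrite -setUA -spanU => h; split.
  - by rewrite subUset UE (edges_sub wp).
  - apply: leq_trans (leq_card_setU _ _) _.
    by rewrite /= mulSn addnC leq_add // -sp card_edges.
  - by move: h Ud; clear; rewrite /=; lia.
  - rewrite spanU setUA inE -ep; by rewrite wU.
  - move=> j; rewrite inE => /orP[/Ups[q qps jq]|jp].
      by exists q => //; rewrite inE qps orbT.
    by exists p; rewrite ?mem_head.
by exists U.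
Qed.

(** * Counting walks *)

Definition outs E l x : seq (I * V) :=
  [seq a <- enum {: I * V} |
    [&& a.1 \in E, ed a.1 == [set x; a.2] & l != Some a.1]].

Fixpoint walks E n l x : seq (seq (I * V)) :=
  if n is n'.+1 then
    [seq a :: s | a <- outs E l x, s <- walks E n' (Some a.1) a.2]
  else [:: [::]].

Lemma walksP E n l x s : s \in walks E n l x -> nbwalk E l x s /\ size s = n.
Proof.
elim: n l x s => [|n IHn] l x s; first by rewrite inE => /eqP ->.
case/allpairsPdep=> a [s' [+ /IHn[ws <-] ->]].
by rewrite mem_filter /= ws => /andP[/and3P[-> -> ->]].
Qed.

Lemma walks_uniq E n l x : uniq (walks E n l x).
Proof.
elim: n l x => //= n IHn l x; apply: allpairs_uniq_dep => //.
  by rewrite filter_uniq // enum_uniq.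
by move=> [a s] [b s'] _ _ /= [-> ->].
Qed.

Lemma outs_size d E l x :
  (forall j, j \in E -> #|ed j| = 2) ->
  d < #|[set j in E | x \in ed j]| -> d <= size (outs E l x).
Proof.
move=> ed2 dx; rewrite -(size_map fst).
set D := [set j in E | x \in ed j] in dx *.
have {}dx : d <= #|[set j in D | l != Some j]|.
  case: l => [j0|].
    have -> : [set j in D | Some j0 != Some j] = D :\ j0.
      by apply/setP=> j; rewrite !inE andbC eq_sym.
    by move: dx; rewrite (cardsD1 j0 D); case: (j0 \in D); clear; lia.
  have -> : [set j in D | None != Some j] = D by apply/setP=> j; rewrite inE andbT.
  exact: ltnW.
apply: leq_trans dx _; apply: leq_trans (card_size _); apply: subset_leq_card.
apply/subsetP => j; rewrite !inE => /andP[/andP[jE xj] lj].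
have /cards2P[y [z [_ ejyz]]] : #|ed j| == 2 by rewrite ed2.
have [w ew] : exists w, ed j = [set x; w].
  move: xj; rewrite ejyz !inE => /orP[/eqP->|/eqP->]; first by exists z.
  by exists y; rewrite setUC.
by apply/mapP; exists (j, w); rewrite // mem_filter /= jE ew eqxx lj mem_enum.
Qed.

Lemma walks_size d E X n l x :
  (forall j, j \in E -> #|ed j| = 2) -> span E \subset X ->
  (forall v, v \in X -> d < #|[set j in E | v \in ed j]|) ->
  x \in X -> d ^ n <= size (walks E n l x).
Proof.
move=> ed2 EX dX; elim: n l x => //= n IHn l x xX.
rewrite size_allpairs_dep sumnE big_map.
apply: (@leq_trans (\sum_(a <- outs E l x) d ^ n)).
  by rewrite big_const_seq count_predT iter_addn_0 expnS mulnC leq_mul2l outs_size ?orbT // dX.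
rewrite big_seq [X in _ <= X]big_seq; apply: leq_sum => a; rewrite mem_filter.
case/andP=> /and3P[aE /eqP ea _] _; apply: IHn.
by apply: (subsetP EX); apply: (subsetP (sub_span aE)); rewrite ea !inE eqxx orbT.
Qed.

Lemma endpoint_pigeonhole r x (ws : seq (seq (I * V))) :
  r * #|V| < size ws -> exists w, r < count (fun s => endpoint x s == w) ws.
Proof.
move=> rV; apply/existsP; apply: contraLR rV; rewrite negb_exists -leqNgt.
move/forallP=> rw; rewrite -sum1_size (partition_big (endpoint x) predT) //=.
rewrite mulnC -sum_nat_const; apply: leq_sum => w _.
by rewrite -big_filter sum1_size size_filter leqNgt; apply: rw.
Qed.

Lemma sparse_min_degree_dense t r d X E :
  0 < t -> sparse t E -> X != set0 ->
  (forall j, j \in E -> #|ed j| = 2) -> span E \subset X ->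
  (forall v, v \in X -> d < #|[set j in E | v \in ed j]|) ->
  r * #|V| < d ^ t ->
  exists U, [/\ U \subset E, #|U| <= r.+1 * t & #|span U| + r <= #|U| + 1].
Proof.
move=> t0 spE /set0Pn[x xX] ed2 EX dX rd.
have [w] := endpoint_pigeonhole x (leq_trans rd (walks_size t None ed2 EX dX xX)).
rewrite -size_filter; set ws := filter _ _ => rw.
have sp : size (take r.+1 ws) = r.+1 by rewrite size_takel.
have [||p|U [UE Ut Ud]] := @theta_dense t E x w (take r.+1 ws) spE t0.
- by rewrite -size_eq0 sp.
- by rewrite take_uniq // filter_uniq // walks_uniq.
- by move/mem_take; rewrite mem_filter => /andP[/eqP ep /walksP[wp sz]].
exists U; split=> //; first by rewrite sp in Ut.
have := subset_leq_card (subsetUr [set x] (span U)).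
by move: Ud; rewrite sp; clear; lia.
Qed.

(** * Destroying short cycles, and minimum degree *)

(** [F] is a minimal set of edges that meets every set [J] violating sparsity.
    By minimality each [e] in [F] has such a [J] with [F :&: J = [set e]].  If
    [r] edges of [F] meet at [v], the union of their sets [J] is dense: vertex
    count minus edge count is submodular, and the part that a new [J] shares with
    the previous union is either empty of edges, but contains [v], or avoids [F]
    and hence has more vertices than edges. *)
Lemma short_cycles_hitting t r E :
  (exists U, [/\ U \subset E, #|U| <= r * t & #|span U| + r <= #|U| + 1])
  \/ exists F, [/\ F \subset E, sparse t (E :\: F)
       & forall v, #|[set j in F | v \in ed j]| < r].
Proof.
pose bad J := [&& J \subset E, J != set0, #|J| <= t & #|span J| <= #|J|].
pose hits F := [forall J, bad J ==> (F :&: J != set0)].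
have hitsE : hits E.
  by apply/forallP=> J; apply/implyP=> /and4P[JE J0 _ _]; rewrite (setIidPr JE).
have [F /minsetP[hF minF] FE] := minset_exists hitsE.
have [/existsP[v rv]|] := boolP [exists v, r <= #|[set j in F | v \in ed j]|];
  last first.
  rewrite negb_exists => /forallP hv; right; exists F; split=> //; last first.
    by move=> v; rewrite ltnNge hv.
  move=> J JEF J0 Jt; rewrite ltnNge; apply/negP => badJ.
  have /implyP := forallP hF J; rewrite /bad J0 Jt badJ andbT.
  move: JEF; rewrite subsetD => /andP[-> JF] /(_ isT) /set0Pn[j].
  by rewrite inE andbC => /andP[jJ]; apply/negP; rewrite (disjointFr JF).
left.
suff grow js : uniq js -> {subset js <= [set j in F | v \in ed j]} ->
    exists U, [/\ U \subset E, #|U| <= size js * t,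
      #|v |: span U| + size js <= #|U| + 1 & U :&: F = [set j in js]].
  have [js [ujs sjs subjs]] := card_geqP rv.
  have [U [UE Ut Ud _]] := grow js ujs subjs; exists U; rewrite -sjs; split=> //.
  by apply: leq_trans Ud; rewrite leq_add2r subset_leq_card // subsetUr.
elim: js => [_ _|e js IHjs /= /andP[ejs ujs] sub].
  (* The vertex v is counted from the start, as if every J contained it; this
     makes the first J obey the same rule as the others. *)
  exists set0; rewrite span0 setU0 cards0 cards1 sub0set set0I; split=> //.
have [|U [UE Ut Ud UF]] := IHjs ujs.
  by move=> j jjs; apply: sub; rewrite inE jjs orbT.
have := sub e (mem_head _ _); rewrite inE => /andP[eF ve].
have [B badB BF] : exists2 B, bad B & F :&: B = [set e].
  have : ~~ hits (F :\ e).
    apply/negP => /minF/(_ (subsetDl _ _)) FF.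
    by move: eF; rewrite -FF !inE eqxx.
  rewrite negb_forall => /existsP[B]; rewrite negb_imply negbK => /andP[badB /eqP FB].
  exists B => //; have := forallP hF B; rewrite badB /= => /set0Pn[j jFB].
  have je i : i \in F :&: B -> i = e.
    move=> iFB; apply/eqP; apply: contraT => ie.
    have : i \in (F :\ e) :&: B by move: iFB; rewrite !inE ie.
    by rewrite FB inE.
  apply/setP=> i; rewrite [RHS]inE; apply/idP/eqP => [/je //|->].
  by rewrite -(je j).
have /and4P[BE B0 Bt Bd] := badB.
have eB : e \in B by have := set11 e; rewrite -BF inE => /andP[].
have meet : #|U :&: B| < #|(v |: span U) :&: span B|.
  have [UB0|UB0] := eqVneq (U :&: B) set0.
    rewrite UB0 cards0; apply/card_gt0P; exists v; rewrite !inE eqxx /=.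
    by apply: (subsetP (sub_span eB)).
  apply: (@leq_trans #|span (U :&: B)|); last first.
    apply/subset_leq_card; rewrite subsetI (spanS (subsetIr _ _)) andbT.
    exact: subset_trans (spanS (subsetIl _ _)) (subsetUr _ _).
  rewrite ltnNge; apply/negP => UBd.
  have : bad (U :&: B).
    rewrite /bad (subset_trans (subsetIr _ _) BE) UB0 UBd andbT.
    exact: leq_trans (subset_leq_card (subsetIr _ _)) Bt.
  have /implyP h := forallP hF (U :&: B); case/h/set0Pn => j.
  rewrite !inE => /and3P[jF jU jB].
  have : j \in [set e] by rewrite -BF inE jF.
  have : j \in [set j in js] by rewrite -UF inE jU.
  by rewrite !inE => jjs /eqP je; move: ejs; rewrite -je jjs.
exists (U :|: B); split.
- by rewrite subUset UE.
- apply: leq_trans (leq_card_setU _ _) _.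
  by rewrite /= mulSn addnC leq_add.
- rewrite spanU setUA /=.
  have := cardsUI (v |: span U) (span B); have := cardsUI U B.
  move: meet Ud Bd; clear;
  move: #|U :&: B| #|(v |: span U) :&: span B| #|v |: span U :|: span B| #|U :|: B|
    #|v |: span U| #|span B| #|B| #|U| (size js); lia.
- rewrite setIUl UF (setIC B) BF; apply/setP=> j; rewrite !inE orbC //.
Qed.

(** In a minimal nonempty vertex set [X] inducing at least [D * #|X|] edges, a
    vertex of degree at most [D] could be removed. *)
Lemma min_degree_subset D E :
  (forall j, j \in E -> #|ed j| = 2) -> 0 < D -> 0 < #|V| -> D * #|V| <= #|E| ->
  exists2 X, X != set0 &
    forall v, v \in X ->
      D < #|[set j in [set j in E | ed j \subset X] | v \in ed j]|.
Proof.
move=> ed2 D0 V0 DE; pose ins X := [set j in E | ed j \subset X].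
pose heavy X := (X != set0) && (D * #|X| <= #|ins X|).
have heavyT : heavy setT.
  rewrite /heavy -card_gt0 cardsT V0; apply: leq_trans DE _.
  by apply: subset_leq_card; apply/subsetP=> j jE; rewrite inE jE subsetT.
have [X /minsetP[/andP[X0 hX] minX] _] := minset_exists heavyT.
exists X => // v vX; rewrite ltnNge; apply/negP => dv.
have cX := cardsD1 v X; rewrite vX in cX.
have cI : #|ins X| = #|[set j in ins X | v \in ed j]| + #|ins (X :\ v)|.
  rewrite -(cardsID [set j | v \in ed j] (ins X)).
  have -> : ins X :&: [set j | v \in ed j] = [set j in ins X | v \in ed j].
    by apply/setP=> j; rewrite !inE.
  congr (_ + #|pred_of_set _|); apply/setP=> j; rewrite !inE subsetD1.
  by case: (v \in ed j); rewrite ?andbF ?andbT.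
have : heavy (X :\ v).
  have hv : D * #|X :\ v| <= #|ins (X :\ v)|.
    by move: hX dv; rewrite cX cI mulnDr muln1 -/(ins X); clear; lia.
  rewrite /heavy hv andbT; apply/negP => /eqP Xv.
  have Xv1 : X = [set v] by rewrite -(setD1K vX) Xv setU0.
  have : ins X = set0.
    apply/setP=> j; rewrite !inE; apply/negP => /andP[jE].
    by move/subset_leq_card; rewrite ed2 // Xv1 cards1.
  by move=> I0; move: hX; rewrite I0 Xv1 cards0 cards1 muln1 leqNgt D0.
move/minX => /(_ (subsetDl _ _)) XX; by move: vX; rewrite -XX !inE eqxx.
Qed.

(** The additive term [r - 1] pays for the edges deleted at each vertex in order
    to destroy the short cycles. *)
Lemma dense_subgraph t r d E :
  (forall j, j \in E -> #|ed j| = 2) -> 0 < t -> 0 < r -> 0 < #|V| ->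
  r * #|V| < d ^ t -> (d + r - 1) * #|V| <= #|E| ->
  exists U, [/\ U \subset E, #|U| <= r.+1 * t & #|span U| + r <= #|U| + 1].
Proof.
move=> ed2 t0 r0 V0 rd dE.
have d0 : 0 < d by case: d rd {dE} => //; rewrite exp0n.
have D0 : 0 < d + r - 1 by move: d0 r0; clear; lia.
have [X X0 dX] := min_degree_subset ed2 D0 V0 dE.
set EX := [set j in E | ed j \subset X] in dX.
have EXE : EX \subset E by apply/subsetP=> j; rewrite inE => /andP[].
case: (short_cycles_hitting t r EX) => [[U [UE Ut Ud]]|[F [FE spF dF]]].
  exists U; split=> //; first exact: subset_trans UE EXE.
  by apply: leq_trans Ut _; rewrite leq_mul2r leqnSn orbT.
have sDE : EX :\: F \subset E by apply: subset_trans EXE; apply: subsetDl.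
have [||v vX||U [UE Ut Ud]] := sparse_min_degree_dense (d := d) (r := r) t0 spF X0.
- by move=> j /(subsetP sDE); apply: ed2.
- by apply/bigcupsP => j; rewrite !inE => /and3P[].
- have := dX v vX; rewrite -(cardsID F) => dv.
  have h1 : #|[set j in EX | v \in ed j] :&: F| <= #|[set j in F | v \in ed j]|.
    apply: subset_leq_card; apply/subsetP=> j.
    by rewrite !inE => /andP[/andP[_ ->] ->].
  rewrite (_ : [set j in EX :\: F | _] = [set j in EX | v \in ed j] :\: F).
    by move: dv h1 (dF v) r0; clear; lia.
  by apply/setP=> j; rewrite !inE -!andbA.
- by [].
by exists U; split=> //; apply: subset_trans UE sDE.
Qed.

End Multigraph.

(** * Links in a batch code *)

Lemma ffact_leq_expn n m : n ^_ m <= n ^ m.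
Proof. by elim: m => // m IHm; rewrite ffactnSr expnSr leq_mul ?leq_subr. Qed.

Section Links.
Variables (H : multihypergraph) (r k : nat).
Hypotheses (r2 : 2 <= r) (Hr : uniform r H)
  (Hk : is_CBC (hsize H) k (Defs.order H) H).
Local Notation n := (Defs.order H).

Definition link (S : {set vertex H}) : {set 'I_(hsize H)} :=
  [set j | S \subset edge j].

Lemma card_link t d (S : {set vertex H}) :
  #|S| = r - 2 -> 0 < t -> r.+1 * t <= k -> 0 < n -> r * n < d ^ t ->
  #|link S| < (d + r - 1) * n.
Proof.
move=> Sr t0 tk n0 rd; rewrite ltnNge; apply/negP => dS.
have ed2 j : j \in link S -> #|edge j :\: S| = 2.
  by rewrite inE => Sj; rewrite cardsD (setIidPr Sj) Hr Sr; move: r2; clear; lia.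
have r0 : 0 < r by apply: ltnW.
have [U [_ Ut Ud]] := dense_subgraph ed2 t0 r0 n0 rd dS.
have [_ _ cbc] := Hk.
have U0 : 0 < #|U| by move: Ud r2; clear; lia.
have := cbc #|U|; rewrite U0 (leq_trans Ut tk) => /(_ isT U erefl).
apply/negP; rewrite -ltnNge.
have sub : \bigcup_(j in U) edge j \subset S :|: span (fun j => edge j :\: S) U.
  apply/bigcupsP => j jU; apply/subsetP => z zj; rewrite inE.
  have [//|zS /=] := boolP (z \in S).
  by apply/bigcupP; exists j => //; rewrite inE zS.
apply: leq_ltn_trans (subset_leq_card sub) _.
apply: leq_ltn_trans (leq_card_setU _ _) _.
by rewrite Sr; move: Ud r2; clear; move: #|span _ U| #|U|; lia.
Qed.

(** Each hyperedge lies in the links of its subsets of size r - 2. *)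
Lemma sum_card_link :
  \sum_(S : {set vertex H} | #|S| == r - 2) #|link S| = hsize H * 'C(r, 2).
Proof.
have -> : \sum_(S : {set vertex H} | #|S| == r - 2) #|link S| =
    \sum_(S : {set vertex H} | #|S| == r - 2) \sum_(j | S \subset edge j) 1.
  by apply: eq_bigr => S _; rewrite sum1_card; apply: eq_card => j; rewrite inE.
rewrite (exchange_big_dep predT) //=.
transitivity (\sum_(j < hsize H) 'C(r, 2)); last first.
  by rewrite sum_nat_const card_ord.
apply: eq_bigr => j _; rewrite sum1_card -bin_sub //.
have := cards_draws (edge j) (r - 2); rewrite Hr => <-.
by rewrite cardsE; apply: eq_card => S; rewrite !unfold_in /= andbC.
Qed.

Lemma size_bound t d :
  0 < t -> r.+1 * t <= k -> r - 2 <= n -> 0 < n -> r * n < d ^ t ->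
  hsize H * r`! < 2 * n ^ (r - 1) * (d + r - 1).
Proof.
move=> t0 tk rn n0 rd; set D := d + r - 1.
have C0 : 0 < 'C(n, r - 2) by rewrite bin_gt0.
have lt : hsize H * 'C(r, 2) < 'C(n, r - 2) * (D * n).
  rewrite -sum_card_link -[n in 'C(n, _)]/(#|vertex H|) -card_draws -sum_nat_const.
  rewrite [X in _ < X](eq_bigl (fun S : {set vertex H} => #|S| == r - 2)); last first.
    by move=> S; rewrite inE.
  have [S0 S0r] : exists S : {set vertex H}, #|S| == r - 2.
    by move: C0; rewrite -card_draws card_gt0 => /set0Pn[S]; rewrite inE; exists S.
  rewrite (bigD1 S0) //= [X in _ < X](bigD1 S0) //= -addSn; apply: leq_add.
    by apply: (@card_link t) => //; apply/eqP.
  by apply: leq_sum => S /andP[/eqP Sr _]; apply/ltnW; apply: (@card_link t).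
have rE : r`! = 2 * (r - 2)`! * 'C(r, 2).
  by rewrite -(bin_fact r2) mulnC.
have f0 : 0 < 2 * (r - 2)`! by rewrite muln_gt0 fact_gt0.
rewrite rE mulnCA; apply: (@leq_trans (2 * (r - 2)`! * ('C(n, r - 2) * (D * n)))).
  by rewrite ltn_pmul2l.
rewrite mulnA -(mulnA 2) (mulnC _`!) bin_ffact.
have -> : r - 1 = (r - 2).+1 by move: r2; clear; lia.
set m := r - 2;
have -> : 2 * n ^_ m * (D * n) = n ^_ m * (2 * n * D) by ring.
have -> : 2 * n ^ m.+1 * D = n ^ m * (2 * n * D) by rewrite expnS; ring.
by rewrite leq_mul2r ffact_leq_expn orbT.
Qed.
End Links.

(** * The bound over the reals *)

Local Open Scope ring_scope.

Theorem corollary9 (R : realType) (n k r : nat)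
    (hr : (2 <= r)%N) (hk : (2 * r + 2 <= k)%N) (hn : (k <= n)%N) :
  let C : R := r%:R `^ (1 / (k %/ (r + 1))%:R) in
  is_true ((max_size n r k)%:R <
    2 * C / (r`!)%:R * n%:R `^ (r%:R - 1 + 1 / (k %/ (r + 1))%:R)
    + 2 / ((r - 1)`!)%:R * n%:R ^+ (r - 1) :> R).
Proof.
set t := (k %/ (r + 1))%N => C; set m := max_size n r k.
have rk : (r < k)%N by move: hk; clear; lia.
have [[H [Hr HC]] _] := max_sizeP n rk; rewrite -/m in HC.
have t0 : (0 < t)%N by rewrite divn_gt0 addn1.
have tk : (r.+1 * t <= k)%N by rewrite mulnC -addn1; apply: leq_divM.
have exd : exists d, (r * n < d ^ t)%N.
  exists (r * n).+1; apply: (@leq_trans ((r * n).+1 ^ 1)); first by rewrite expn1.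
  by rewrite leq_pexp2l.
have n0 : (0 < n)%N by apply: leq_trans hn; apply: leq_ltn_trans rk.
(* Minimality of d gives (d - 1) ^ t <= r n, so that d - 1 is at most
   C n ^ (1 / t). *)
case: (ex_minnP exd) => d rd mind.
have d0 : (0 < d)%N by case: d rd {mind} => //; rewrite exp0n.
have le : (d.-1 ^ t <= r * n)%N.
  by rewrite leqNgt; apply/negP => /mind; rewrite -ltnS prednK // ltnn.
have [on hm _] := HC.
have bound : (m * r`! < 2 * n ^ (r - 1) * (d + r - 1))%N.
  have HC' : is_CBC (hsize H) k (Defs.order H) H by rewrite on hm.
  have rn : (r - 2 <= n)%N by apply: leq_trans hn; move: rk; clear; lia.
  by have := size_bound hr Hr HC' t0 tk; rewrite on hm; apply.
have f0 : (0 : R) < (r`!)%:R by rewrite ltr0n fact_gt0.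
have dle : (d.-1%:R : R) <= C * n%:R `^ (1 / t%:R).
  rewrite /C -powRM ?ler0n //.
  have -> : (d.-1%:R : R) = (d.-1%:R `^ t%:R) `^ (1 / t%:R).
    by rewrite -powRrM mulrCA mulfV ?mulr1 ?powRr1 ?ler0n // pnatr_eq0 -lt0n.
  rewrite ge0_ler_powR ?nnegrE ?powR_ge0 ?divr_ge0 ?mulr_ge0 ?ler0n //.
  by rewrite powR_mulrn ?ler0n // -natrX -natrM ler_nat.
have n0R : (n%:R : R) != 0 by rewrite pnatr_eq0 -lt0n.
have -> : n%:R `^ (r%:R - 1 + 1 / t%:R) = n%:R ^+ (r - 1) * n%:R `^ (1 / t%:R) :> R.
  rewrite powRD; last by rewrite n0R implybT.
  have -> : r%:R - 1 = (r - 1)%:R :> R by rewrite natrB // ltnW.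
  by rewrite powR_mulrn ?ler0n.
have fr : (r`!)%:R = r%:R * ((r - 1)`!)%:R :> R.
  by rewrite -natrM -[in LHS](prednK (ltnW hr)) factS prednK ?subn1 // ltnW.
have rf0 : ((r - 1)`!)%:R != 0 :> R by rewrite pnatr_eq0 -lt0n fact_gt0.
have r0 : (r%:R : R) != 0 by rewrite pnatr_eq0 -lt0n ltnW.
have -> : 2 / ((r - 1)`!)%:R = 2 * r%:R / (r`!)%:R :> R.
  by rewrite fr; field; rewrite r0 rf0.
rewrite -(ltr_pM2r f0).
apply: (@lt_le_trans _ _ (2 * n%:R ^+ (r - 1) * (d.-1%:R + r%:R))).
  rewrite -natrX -!natrM -natrD -natrM ltr_nat.
  by have -> : (d.-1 + r = d + r - 1)%N by move: d0; clear; lia.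
apply: (@le_trans _ _ (2 * n%:R ^+ (r - 1) * (C * n%:R `^ (1 / t%:R) + r%:R))).
  by rewrite ler_wpM2l ?lerD2r // mulr_ge0 ?exprn_ge0 ?ler0n.
rewrite le_eqVlt; apply/predU1P; left.
move: (n%:R ^+ (r - 1)) (n%:R `^ _) => X Y; field.
by rewrite lt0r_neq0.
Qed.
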